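(* For a semiring $S$ the following conditions are equivalent: (1) All left $S$-semimodules are e-injective. (2) $S$ is a (classical) semisimple ring.
   Context: A semiring is $(S,+,\cdot,0,1)$ with $(S,+,0)$ a commutative monoid, $(S,\cdot,1)$ a monoid, multiplication distributing over addition on both sides, and $0s=0=s0$ for all $s$. A left $S$-semimodule is a commutative monoid $(M,+,0)$ with a scalar multiplication $S\times M\to M$ satisfying $(ss')m=s(s'm)$, $s(m+m')=sm+sm'$, $(s+s')m=sm+s'm$, $1m=m$, $s0=0=0m$. Homomorphisms preserve $+$, $0$ and scalar multiplication; ${}_S\mathcal{M}$ is the category of left $S$-semimodules and $\mathcal{M}$ the category of commutative monoids. A sequence $0\to A\xrightarrow{f}B\xrightarrow{g}C\to 0$ in ${}_S\mathcal{M}$ (or in $\mathcal{M}$) is short exact if $f$ is a categorical kernel of $g$ and $g$ is a categorical cokernel of $f$ (kernels and cokernels in the sense of categories with zero morphisms). $M\in{}_S\mathcal{M}$ is e-injective if the contravariant functor $\mathrm{Hom}_S(-,M):{}_S\mathcal{M}\to\mathcal{M}$ sends every short exact sequence $0\to A\to B\to C\to 0$ to a short exact sequence $0\to\mathrm{Hom}_S(C,M)\to\mathrm{Hom}_S(B,M)\to\mathrm{Hom}_S(A,M)\to 0$ in $\mathcal{M}$. *)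

(* Defs.v *)
From HB Require Import structures.
From mathcomp Require Import all_boot all_order all_algebra.
From mathcomp Require Import boolp classical_sets cardinality fsbigop.

Set Implicit Arguments.
Unset Strict Implicit.
Unset Printing Implicit Defensive.

Import GRing.Theory.
Local Open Scope classical_set_scope.
Local Open Scope ring_scope.

(* Semirings are [pzSemiRingType]s (0 = 1 is allowed), left S-semimodules are
   [lSemiModType S]s with the maps [{linear A -> B}] as homomorphisms, and
   commutative monoids are [nmodType]s with the maps [{additive A -> B}].
   The decidable equality and choice operator bundled in these structures
   exist on every type by the axioms of [boolp]. *)

(* Morphisms are compared pointwise, which by [funext] and [Prop_irrelevance]
   is the same as equality of the bundled maps. *)
Section SemimoduleExactness.
Variables (S : pzSemiRingType) (A B C : lSemiModType S).

Definition is_kernel (f : {linear A -> B}) (g : {linear B -> C}) : Prop :=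
  (forall a, g (f a) = 0) /\
  forall (X : lSemiModType S) (h : {linear X -> B}),
    (forall x, g (h x) = 0) ->
    exists k : {linear X -> A},
      f \o k =1 h /\ forall k' : {linear X -> A}, f \o k' =1 h -> k' =1 k.

Definition is_cokernel (g : {linear B -> C}) (f : {linear A -> B}) : Prop :=
  (forall a, g (f a) = 0) /\
  forall (X : lSemiModType S) (h : {linear B -> X}),
    (forall a, h (f a) = 0) ->
    exists k : {linear C -> X},
      k \o g =1 h /\ forall k' : {linear C -> X}, k' \o g =1 h -> k' =1 k.

Definition short_exact (f : {linear A -> B}) (g : {linear B -> C}) : Prop :=
  is_kernel f g /\ is_cokernel g f.

End SemimoduleExactness.

Section MonoidExactness.
Variables A B C : nmodType.

Definition nmod_is_kernel (f : {additive A -> B}) (g : {additive B -> C}) :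
    Prop :=
  (forall a, g (f a) = 0) /\
  forall (X : nmodType) (h : {additive X -> B}),
    (forall x, g (h x) = 0) ->
    exists k : {additive X -> A},
      f \o k =1 h /\ forall k' : {additive X -> A}, f \o k' =1 h -> k' =1 k.

Definition nmod_is_cokernel (g : {additive B -> C}) (f : {additive A -> B}) :
    Prop :=
  (forall a, g (f a) = 0) /\
  forall (X : nmodType) (h : {additive B -> X}),
    (forall a, h (f a) = 0) ->
    exists k : {additive C -> X},
      k \o g =1 h /\ forall k' : {additive C -> X}, k' \o g =1 h -> k' =1 k.

Definition nmod_short_exact (f : {additive A -> B}) (g : {additive B -> C}) :
    Prop :=
  nmod_is_kernel f g /\ nmod_is_cokernel g f.

End MonoidExactness.

Section HomMonoid.
Variables (S : pzSemiRingType) (U V : lSemiModType S).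

HB.instance Definition _ := gen_eqMixin {linear U -> V}.
HB.instance Definition _ := gen_choiceMixin {linear U -> V}.

Lemma linear_eqP (f g : {linear U -> V}) : f =1 g -> f = g.
Proof.
case: f g => [f [[f1] [f2]]] [g [[g1] [g2]]] /= /funext efg.
case: _ / efg g1 g2 => g1 g2.
by rewrite (Prop_irrelevance f1 g1) (Prop_irrelevance f2 g2).
Qed.

Definition hom0 : {linear U -> V} := \0.
Definition hom_add (f g : {linear U -> V}) : {linear U -> V} := f \+ g.

Lemma hom_addA : associative hom_add.
Proof. by move=> f g h; apply: linear_eqP => x /=; rewrite addrA. Qed.

Lemma hom_addC : commutative hom_add.
Proof. by move=> f g; apply: linear_eqP => x /=; rewrite addrC. Qed.

Lemma hom_add0 : left_id hom0 hom_add.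
Proof. by move=> f; apply: linear_eqP => x /=; rewrite add0r. Qed.

HB.instance Definition _ :=
  GRing.isNmodule.Build {linear U -> V} hom_addA hom_addC hom_add0.

End HomMonoid.

Section HomFunctor.
Variables (S : pzSemiRingType) (M A B : lSemiModType S) (f : {linear A -> B}).

(* Hom_S(f, M) : Hom_S(B, M) -> Hom_S(A, M) *)
Definition hom_precomp (h : {linear B -> M}) : {linear A -> M} := h \o f.

Lemma hom_precomp_is_nmod_morphism : nmod_morphism hom_precomp.
Proof. by split=> [|h k]; apply: linear_eqP. Qed.

HB.instance Definition _ :=
  GRing.isNmodMorphism.Build {linear B -> M} {linear A -> M} hom_precomp
    hom_precomp_is_nmod_morphism.

End HomFunctor.
Arguments hom_precomp {S} M {A B} f h.

Definition e_injective (S : pzSemiRingType) (M : lSemiModType S) : Prop :=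
  forall (A B C : lSemiModType S) (f : {linear A -> B}) (g : {linear B -> C}),
    short_exact f g -> nmod_short_exact (hom_precomp M g) (hom_precomp M f).

Definition simple_submodule (S : pzSemiRingType) (M : lSemiModType S)
    (N : {pred M}) : Prop :=
  [/\ GRing.subsemimod_closed N,
      exists2 x, x \in N & x != 0
    & forall L : {pred M}, GRing.subsemimod_closed L -> {subset L <= N} ->
        L =i pred1 0 \/ L =i N].

(* M is the internal direct sum of the N i: every element is, in exactly one
   way, a sum of a finitely supported family of elements of the N i. *)
Definition is_direct_sum (S : pzSemiRingType) (M : lSemiModType S)
    (I : choiceType) (N : I -> {pred M}) : Prop :=
  forall x : M, exists! f : I -> M,
    [/\ forall i, f i \in N i,
        finite_set [set i | f i != 0]
      & x = \sum_(i \in [set: I]) f i].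

Definition semisimple (S : pzSemiRingType) (M : lSemiModType S) : Prop :=
  exists (I : choiceType) (N : I -> {pred M}),
    (forall i, simple_submodule (N i)) /\ is_direct_sum N.

Definition is_ring (S : pzSemiRingType) : Prop :=
  forall x : S, exists y : S, x + y = 0.

(* [simple_submodule] and [semisimple] have their classical meaning here: over
   a ring, subsemimodules are exactly submodules, as -1 acts by negation. *)
Definition semisimple_ring (S : pzSemiRingType) : Prop :=
  is_ring S /\ semisimple S^o.

(* Main.v *)
Require Import Defs.
From HB Require Import structures.
From mathcomp Require Import all_boot all_order all_algebra.
From mathcomp Require Import boolp classical_sets functions cardinality fsbigop.

(* (1) => (2).  A subtractive subsemimodule N of B and the Bourne quotient of B
   by N form a short exact sequence; as cokernels of commutative monoids are
   surjective, e-injectivity of N yields a linear retraction r of B onto N.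
   Apply this first to the sequences u in S^nat whose terms u_n are additively
   invertible for almost all n: for every n, r(1, 1, ...) is the sum of the n-th
   unit sequence and another sequence, so its n-th term is 1 plus something;
   for large n it is invertible, hence so is 1.  Now S is a ring and every left
   ideal is a direct summand.  If the sum T of the simple left ideals did not
   contain 1, a left ideal L maximal among those containing T but not 1 would
   have a simple complement, which lies in T, hence in L: a contradiction.  So 1
   is a finite sum of elements of simple left ideals, and a shortest such
   expression gives a direct decomposition.

   (2) => (1).  Every short exact sequence splits, and Hom(-, M) preserves split
   exact sequences.  For the splitting of A in B take by Zorn's lemma N maximal
   with N meeting A trivially; if e b lies outside N + A for some e in a simple
   left ideal E, then E b meets N + A trivially and N + E b contradicts the
   maximality of N. *)

Set Implicit Arguments.
Unset Strict Implicit.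
Unset Printing Implicit Defensive.

Import GRing.Theory.
Local Open Scope ring_scope.

(** * Subsemimodules and Bourne quotients *)

Definition subtractive (M : nmodType) (N : {pred M}) : Prop :=
  forall a b, a \in N -> a + b \in N -> b \in N.

Definition linear_of (S : pzSemiRingType) (U V : lSemiModType S) (f : U -> V)
    (lin_f : semilinear f) : {linear U -> V} :=
  HB.pack_for {linear U -> V} f
    (GRing.isSemilinear.Build S U V *:%R f lin_f).

Section Subsemimodule.
Variables (S : pzSemiRingType) (B : lSemiModType S) (N : {pred B}).

Definition subsemimodule of GRing.subsemimod_closed N := {x : B | x \in N}.
Hypothesis cN : GRing.subsemimod_closed N.
Local Notation A := (subsemimodule cN).

HB.instance Definition _ := Choice.on A.
HB.instance Definition _ := SubChoice.on A.
HB.instance Definition _ :=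
  GRing.SubChoice_isSubLSemiModule.Build S B (fun x => x \in N) A cN.

Definition sub_val : {linear A -> B} := (\val : A -> B).

Lemma sub_lift (X : lSemiModType S) (h : {linear X -> B}) :
  (forall x, h x \in N) -> exists k : {linear X -> A}, sub_val \o k =1 h.
Proof.
move=> hN; pose k x : A := Sub (h x) (hN x).
have kE x : val (k x) = h x by rewrite SubK.
have k_lin : semilinear k.
  split=> [a x|x y]; apply: val_inj; rewrite kE.
    by rewrite linearZ -kE -[LHS](linearZ_LR sub_val).
  by rewrite linearD -(kE x) -(kE y) -[LHS](linearD sub_val).
by exists (linear_of k_lin).
Qed.

End Subsemimodule.

Section BourneQuotient.
Variables (S : pzSemiRingType) (B : lSemiModType S) (N : {pred B}).
Hypothesis cN : GRing.subsemimod_closed N.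

(** Without subtraction, congruence modulo [N] allows a correction from [N] on each side. *)
Definition bourne (x y : B) : bool :=
  `[< exists n n', [/\ n \in N, n' \in N & x + n = y + n'] >].

Lemma bourne_refl : reflexive bourne.
Proof. by move=> x; apply/asboolP; exists 0, 0; case: cN => [[]]. Qed.

Lemma bourne_sym : symmetric bourne.
Proof.
by move=> x y; apply/asboolP/asboolP => -[n [n' [Nn Nn' e]]]; exists n', n.
Qed.

Lemma bourne_trans : transitive bourne.
Proof.
have [[_ ND] _] := cN.
move=> y x z /asboolP[n [n' [Nn Nn' e]]] /asboolP[m [m' [Nm Nm' e']]].
apply/asboolP; exists (n + m), (m' + n'); split; try exact: ND.
by rewrite addrA e addrAC e' addrA.
Qed.

Canonical bourne_equiv := EquivRel bourne bourne_refl bourne_sym bourne_trans.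

Definition quotient := {eq_quot bourne}%qT.
HB.instance Definition _ := Choice.on quotient.

Local Open Scope quotient_scope.

Definition quot_pi (x : B) : quotient := \pi_quotient x.

Lemma quot_piP x y :
  quot_pi x = quot_pi y <->
  exists n n', [/\ n \in N, n' \in N & x + n = y + n'].
Proof. by split=> [/eqmodP/asboolP|?]; [|apply/eqmodP/asboolP]. Qed.

Lemma quot_piW (P : quotient -> Prop) :
  (forall x, P (quot_pi x)) -> forall q, P q.
Proof. by move=> Ppi; apply: quotW => x; apply: Ppi. Qed.

Definition quot_add (p q : quotient) := quot_pi (repr p + repr q).
Definition quot_scale (a : S) (p : quotient) := quot_pi (a *: repr p).

Lemma quot_piK q : quot_pi (repr q) = q. Proof. exact: reprK. Qed.

Lemma quot_addE x y : quot_add (quot_pi x) (quot_pi y) = quot_pi (x + y).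
Proof.
have [[_ ND] _] := cN.
have /quot_piP[n [n' [Nn Nn' e]]] := quot_piK (quot_pi x).
have /quot_piP[m [m' [Nm Nm' e']]] := quot_piK (quot_pi y).
apply/quot_piP; exists (n + m), (n' + m'); split; try exact: ND.
by rewrite addrACA e e' addrACA.
Qed.

Lemma quot_scaleE a x : quot_scale a (quot_pi x) = quot_pi (a *: x).
Proof.
have [_ NZ] := cN.
have /quot_piP[n [n' [Nn Nn' e]]] := quot_piK (quot_pi x).
apply/quot_piP; exists (a *: n), (a *: n'); split; try exact: NZ.
by rewrite -!scalerDr e.
Qed.

Let quot_addA : associative quot_add.
Proof.
elim/quot_piW=> x; elim/quot_piW=> y; elim/quot_piW=> z.
by rewrite !quot_addE addrA.
Qed.

Let quot_addC : commutative quot_add.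
Proof. by elim/quot_piW=> x; elim/quot_piW=> y; rewrite !quot_addE addrC. Qed.

Let quot_add0 : left_id (quot_pi 0) quot_add.
Proof. by elim/quot_piW=> x; rewrite !quot_addE add0r. Qed.

HB.instance Definition _ :=
  GRing.isNmodule.Build quotient quot_addA quot_addC quot_add0.

Let quot_scaleA a b v : quot_scale a (quot_scale b v) = quot_scale (a * b) v.
Proof. by elim/quot_piW: v => x; rewrite !quot_scaleE scalerA. Qed.

Let quot_scale0 v : quot_scale 0 v = 0.
Proof. by elim/quot_piW: v => x; rewrite !quot_scaleE scale0r. Qed.

Let quot_scale1 : left_id 1 quot_scale.
Proof. by elim/quot_piW=> x; rewrite !quot_scaleE scale1r. Qed.

Let quot_scaleDr : right_distributive quot_scale +%R.
Proof.
move=> a; elim/quot_piW=> x; elim/quot_piW=> y.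
by rewrite -[_ + _]/(quot_add _ _) quot_addE !quot_scaleE scalerDr -quot_addE.
Qed.

Let quot_scaleDl v : {morph quot_scale^~ v : a b / a + b}.
Proof.
by move=> a b; elim/quot_piW: v => x; rewrite !quot_scaleE scalerDl -quot_addE.
Qed.

HB.instance Definition _ := GRing.Nmodule_isLSemiModule.Build S quotient
  quot_scaleA quot_scale0 quot_scale1 quot_scaleDr quot_scaleDl.

Let quot_pi_semilinear : semilinear quot_pi.
Proof. by split=> [a x|x y]; rewrite -?quot_scaleE -?quot_addE. Qed.

HB.instance Definition _ :=
  GRing.isSemilinear.Build S B quotient *:%R quot_pi quot_pi_semilinear.

(** If [h x] becomes 0 in the quotient, then [h x + n = n'] with [n] and [n'] in [N], so
    subtractivity puts [h x] in [N]. Dually, a map that kills [N] agrees on congruent elements and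
    descends along [quot_pi]. *)
Lemma sub_quot_short_exact :
  subtractive N -> short_exact (sub_val cN) (quot_pi : {linear B -> quotient}).
Proof.
have [[N0 _] _] := cN; move=> sN.
have val0 (a : subsemimodule cN) : quot_pi (sub_val cN a) = 0.
  by apply/quot_piP; exists 0, (\val a); rewrite N0 addr0 add0r (valP a).
split; split=> // X h h0.
  have hN x : h x \in N.
    have /quot_piP[n [n' [Nn Nn' e]]] := h0 x.
    by apply: (sN n) => //; rewrite addrC e add0r.
  have [k kE] := sub_lift cN hN.
  exists k; split=> // k' k'E x; apply: val_inj.
  exact: etrans (k'E x) (esym (kE x)).
have hN n : n \in N -> h n = 0.
  by move=> Nn; apply: (h0 (exist _ n Nn)).
pose k (q : quotient) := h (repr q).
have kE x : k (quot_pi x) = h x.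
  have /quot_piP[n [n' [Nn Nn' /(congr1 h)]]] := quot_piK (quot_pi x).
  by rewrite !linearD (hN n) // (hN n') // !addr0.
have k_lin : semilinear k.
  split=> [a|]; elim/quot_piW=> x; last (elim/quot_piW=> y).
    by rewrite -linearZ !kE linearZ.
  by rewrite -linearD !kE linearD.
exists (linear_of k_lin); split=> [x|k' k'E q] /=; first by rewrite kE.
by elim/quot_piW: q => x; rewrite kE; apply: k'E.
Qed.

End BourneQuotient.

(** * Images of additive maps, and retractions onto subtractive subsemimodules *)

Section AdditiveImage.
Variables (A B : nmodType) (g : {additive A -> B}).

Definition image_pred : {pred B} := fun y => `[< exists x, g x = y >].

Lemma image_pred_closed : addr_closed image_pred.
Proof.
split; first by apply/asboolP; exists 0; rewrite raddf0.
move=> _ _ /asboolP[x <-] /asboolP[y <-].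
by apply/asboolP; exists (x + y); rewrite raddfD.
Qed.

Definition add_image := {y : B | y \in image_pred}.
HB.instance Definition _ := SubChoice.on add_image.
HB.instance Definition _ :=
  GRing.SubChoice_isSubNmodule.Build B (fun y => y \in image_pred) add_image
    image_pred_closed.

Definition image_val : {additive add_image -> B} := (\val : add_image -> B).

Lemma mem_image x : g x \in image_pred.
Proof. by apply/asboolP; exists x. Qed.

Definition corestrict (x : A) : add_image := Sub (g x) (mem_image x).

Lemma corestrict_is_nmod_morphism : nmod_morphism corestrict.
Proof.
split=> [|x y]; apply: (@val_inj _ _ add_image).
  by rewrite SubK raddf0 -[RHS](raddf0 image_val).
by rewrite SubK raddfD -[RHS](raddfD image_val).
Qed.

HB.instance Definition _ :=
  GRing.isNmodMorphism.Build A add_image corestrict corestrict_is_nmod_morphism.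

End AdditiveImage.

(* A cokernel is epi, and it factors through its image. *)
Lemma nmod_cokernel_surj (A B C : nmodType) (f : {additive A -> B})
    (g : {additive B -> C}) :
  nmod_is_cokernel g f -> forall y, exists x, g x = y.
Proof.
move=> [gf0 univ] y.
have [|k [kE _]] := univ _ (corestrict g : {additive B -> add_image g}).
  by move=> a; apply: (@val_inj _ _ (add_image g)); rewrite SubK gf0.
have [i [_ i_uniq]] := univ _ g gf0.
have idE : idfun =1 i by apply: i_uniq.
have kE' : image_val g \o k =1 i.
  by apply: (i_uniq (image_val g \o k)) => x /=; rewrite [k _]kE.
have /asboolP := valP (k y).
by rewrite [\val _]kE' -idE.
Qed.

(** Restricting maps from [B] to [N] is a cokernel, hence surjective; [r] is a preimage of the
    identity of [N], followed by the inclusion. *)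
Lemma subtractive_retract (S : pzSemiRingType) (B : lSemiModType S)
    (N : {pred B}) :
    (forall M : lSemiModType S, e_injective M) ->
    GRing.subsemimod_closed N -> subtractive N ->
  exists r : {linear B -> B},
    (forall b, r b \in N) /\ {in N, forall b, r b = b}.
Proof.
move=> inj cN sN.
have [_ coker] := inj (subsemimodule cN) _ _ _ _ _ (sub_quot_short_exact cN sN).
have [r rE] := nmod_cokernel_surj coker (idfun : {linear _ -> _}).
exists (sub_val cN \o r); split=> [b|b Nb]; first exact: (valP (r b)).
pose b' : subsemimodule cN := exist _ b Nb.
exact: (congr1 (fun h : {linear subsemimodule cN -> _} => \val (h b')) rE).
Qed.

(** * E-injectivity gives additive inverses *)

Section Sequences.
Variable S : pzSemiRingType.

Definition sequence := nat -> S^o.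
HB.instance Definition _ := GRing.Nmodule.on sequence.

Definition seq_scale (a : S) (u : sequence) : sequence := fun n => a * u n.

Let seq_scaleA a b v : seq_scale a (seq_scale b v) = seq_scale (a * b) v.
Proof. by apply: funext => n; apply: mulrA. Qed.

Let seq_scale0 v : seq_scale 0 v = 0.
Proof. by apply: funext => n; apply: mul0r. Qed.

Let seq_scale1 : left_id 1 seq_scale.
Proof. by move=> v; apply: funext => n; apply: mul1r. Qed.

Let seq_scaleDr : right_distributive seq_scale +%R.
Proof. by move=> a u v; apply: funext => n; apply: mulrDr. Qed.

Let seq_scaleDl v : {morph seq_scale^~ v : a b / a + b}.
Proof. by move=> a b; apply: funext => n; apply: mulrDl. Qed.

HB.instance Definition _ := GRing.Nmodule_isLSemiModule.Build S sequence
  seq_scaleA seq_scale0 seq_scale1 seq_scaleDr seq_scaleDl.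

Definition has_opp (x : S) : Prop := exists y, x + y = 0.

Lemma has_oppDr x y : has_opp (x + y) -> has_opp x.
Proof. by case=> z; rewrite -addrA; exists (y + z). Qed.

Lemma has_oppD x y : has_opp x -> has_opp y -> has_opp (x + y).
Proof.
by move=> [x' x0] [y' y0]; exists (x' + y'); rewrite addrACA x0 y0 addr0.
Qed.

Lemma has_oppM a x : has_opp x -> has_opp (a * x).
Proof. by case=> y xy0; exists (a * y); rewrite -mulrDr xy0 mulr0. Qed.

(** Unit sequences lie here because they vanish eventually, whereas the constant sequence 1 lies
    here only if 1 has an opposite. *)
Definition eventually_opp : {pred sequence} :=
  fun u => `[< exists n, forall m, (n <= m)%N -> has_opp (u m) >].

Lemma eventually_opp_closed : GRing.subsemimod_closed eventually_opp.
Proof.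
split; [split|] => [|u v /asboolP[n un] /asboolP[m vm]|a u /asboolP[n un]].
- by apply/asboolP; exists 0%N => m _; exists 0; rewrite addr0.
- apply/asboolP; exists (maxn n m) => k; rewrite geq_max => /andP[nk mk].
  by apply: has_oppD; [apply: un|apply: vm].
- by apply/asboolP; exists n => m nm; apply: has_oppM (un m nm).
Qed.

Lemma eventually_opp_subtractive : subtractive eventually_opp.
Proof.
move=> u v _ /asboolP[n uvn]; apply/asboolP; exists n => m /uvn.
by rewrite -[(u + v) m]/(u m + v m) addrC => /has_oppDr.
Qed.

Lemma e_injective_is_ring :
  (forall M : lSemiModType S, e_injective M) -> is_ring S.
Proof.
move=> /subtractive_retract inj x.
have [r [rN r_id]] := inj _ _ eventually_opp_closed eventually_opp_subtractive.
suff: has_opp 1 by move=> /(has_oppM x); rewrite mulr1.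
have /asboolP[n] := rN (fun=> 1); move/(_ n (leqnn n)).
(* The constant sequence is split at this [n]: [e] has finite support, so [r] fixes it and it
   contributes 1 to the invertible term [n]. *)
pose e : sequence := fun m => if m == n then 1 else 0.
pose e' : sequence := fun m => if m == n then 0 else 1.
have -> : (fun=> 1) = e + e' :> sequence.
  by apply: funext => m; rewrite -[RHS]/(e m + e' m) /e /e';
    case: eqP; rewrite ?addr0 ?add0r.
rewrite linearD r_id; last first.
  by apply/asboolP; exists n.+1 => m /gtn_eqF nm; exists 0; rewrite addr0 /e nm.
by rewrite -[(_ + _) n]/(e n + r e' n) /e eqxx => /has_oppDr.
Qed.

End Sequences.

(** * Maximal subsemimodules, and negation over a ring *)

Lemma maximal_avoiding (S : pzSemiRingType) (M : lSemiModType S)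
    (N0 D : {pred M}) :
    GRing.subsemimod_closed N0 -> {in N0, forall x, x \notin D} ->
  exists N : {pred M}, [/\ GRing.subsemimod_closed N, {subset N0 <= N},
    {in N, forall x, x \notin D}
    & forall N' : {pred M}, GRing.subsemimod_closed N' -> {subset N <= N'} ->
        {in N', forall x, x \notin D} -> {subset N' <= N}].
Proof.
move=> cN0 N0D.
pose to_pred (A : set M) : {pred M} := fun x => `[< A x >].
have memE A x : x \in to_pred A <-> A x by split=> [/asboolP|/asboolP].
pose Q (A : set M) := [/\ GRing.subsemimod_closed (to_pred A),
  forall x, x \in N0 -> A x & forall x, A x -> x \notin D].
(* [Q] is asked of nonempty sets only, since the union of the empty chain is empty and does not
   contain 0. *)
have [|A [QA maxA]] := @Zorn_bigcup M (fun A => forall a, A a -> Q A).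
  move=> F FQ totF a [A FA Aa].
  have QF B x : F B -> B x -> Q B by move=> FB; apply: FQ.
  have [[[A0 _] _] N0A _] := QF A a FA Aa.
  split=> [|x /N0A Ax|x [B FB Bx]]; last 2 first.
  - by exists A.
  - by have [_ _] := QF B x FB Bx; apply.
  split; [split|] => [|x y /memE[B FB Bx] /memE[C FC Cy]|b x /memE[B FB Bx]].
  - by apply/memE; exists A => //; apply/memE.
  - apply/memE; case: (totF B C FB FC) => [BC|CB].
      exists C => //; have [[[_ CD] _] _ _] := QF C y FC Cy.
      by apply/memE/CD; apply/memE => //; apply: BC.
    exists B => //; have [[[_ BD] _] _ _] := QF B x FB Bx.
    by apply/memE/BD; apply/memE => //; apply: CB.
  - apply/memE; exists B => //; have [[_ BZ] _ _] := QF B x FB Bx.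
    by apply/memE/BZ/memE.
(* An empty maximal set would be enlarged by [N0], which contains 0. *)
have [a Aa] : exists a, A a.
  apply: contrapT => noA.
  apply: (maxA [set x | x \in N0]%classic).
    split=> [x Ax|N0A]; first by case: noA; exists x.
    by apply: noA; exists 0; apply: N0A; case: cN0 => [[]].
  move=> _ _; split=> //.
  suff -> : to_pred [set x | x \in N0]%classic = N0 by [].
  by apply: funext => x; apply: asboolb.
have [cA N0A AD] := QA a Aa.
exists (to_pred A).
split=> // [x /N0A /memE //|x /memE /AD //|N' cN' AN' N'D x N'x].
apply/memE; apply: contrapT => nAx.
apply: (maxA [set x | x \in N']%classic).
  by split=> [y /memE /AN' //|N'A]; apply/nAx/N'A.
move=> _ _; split=> // [|y /N0A /memE /AN' //].
suff -> : to_pred [set x | x \in N']%classic = N' by [].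
by apply: funext => y; apply: asboolb.
Qed.

(** [m] is the -1 of [S]; the structures carry no subtraction, so negation is written [m *: x] from
    here on. *)
Lemma ring_opp (S : pzSemiRingType) :
  is_ring S ->
  exists m : S, forall (M : lSemiModType S) (x : M), x + m *: x = 0.
Proof.
move=> /(_ 1)[m m0]; exists m => M x.
by rewrite -[X in X + _]scale1r -scalerDl m0 scale0r.
Qed.

Lemma ring_addrI (S : pzSemiRingType) (M : lSemiModType S) :
  is_ring S -> right_injective (+%R : M -> M -> M).
Proof.
move=> /ring_opp[m mE] x y z /(congr1 (fun t => t + m *: x)).
by rewrite addrAC mE add0r addrAC mE add0r.
Qed.

Lemma ring_subtractive (S : pzSemiRingType) (M : lSemiModType S)
    (N : {pred M}) :
  is_ring S -> GRing.subsemimod_closed N -> subtractive N.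
Proof.
move=> /ring_opp[m mE] [[_ ND] NZ] a b Na Nab.
rewrite -[b]add0r -(mE _ a) addrAC; apply: ND => //; exact: NZ.
Qed.

(** * The socle and the decomposition of 1 *)

Section RingToSemisimple.
Variable S : pzSemiRingType.
Hypothesis ringS : is_ring S.

(* y generates a simple left ideal. *)
Definition atom (y : S) : Prop :=
  y != 0 /\ forall z, z * y != 0 -> exists w, w * (z * y) = y.

Definition cyclic (y : S) : {pred S^o} := fun x => `[< exists a, x = a * y >].

Lemma cyclic_closed y : GRing.subsemimod_closed (cyclic y).
Proof.
split; [split|] => [|_ _ /asboolP[a ->] /asboolP[b ->]|b _ /asboolP[a ->]];
  apply/asboolP.
- by exists 0; rewrite mul0r.
- by exists (a + b); rewrite mulrDl.
- by exists (b * a); apply: mulrA.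
Qed.

Lemma atom_simple y : atom y -> simple_submodule (cyclic y).
Proof.
move=> [y0 yP]; split; first exact: cyclic_closed.
  by exists y => //; apply/asboolP; exists 1; rewrite mul1r.
move=> L [[L0 _] LZ] Ly.
have [[z Lz z0]|noL] := EM (exists2 z, z \in L & z != 0); [right|left] => x.
  apply/idP/idP => [/Ly //|/asboolP[b ->]].
  have /asboolP[a za] := Ly z Lz; rewrite za in z0 Lz.
  by have [w <-] := yP a z0; rewrite mulrA; apply: (LZ _ _ Lz).
apply/idP/eqP => [Lx|->//].
by apply/eqP; apply: contrapT => /negP x0; apply: noL; exists x.
Qed.

(** The sum of all simple left ideals, by generators: each pair holds a coefficient and an atom. *)
Definition socle : {pred S^o} := fun x =>
  `[< exists2 s : seq (S * S), (forall p, p \in s -> atom p.2)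
                             & x = \sum_(p <- s) p.1 * p.2 >].

Lemma socle_closed : GRing.subsemimod_closed socle.
Proof.
split; [split|] => [|_ _ /asboolP[s sA ->] /asboolP[t tA ->]
                    |b _ /asboolP[s sA ->]];
  apply/asboolP.
- by exists [::] => //; rewrite big_nil.
- exists (s ++ t); last by rewrite big_cat.
  by move=> p; rewrite mem_cat => /orP[/sA|/tA].
- exists [seq (b * p.1, p.2) | p <- s]; first by move=> _ /mapP[p /sA pA ->].
  rewrite big_map -[LHS]/(b * _) mulr_sumr.
  by apply: eq_bigr => p _; rewrite mulrA.
Qed.

Lemma e_injective_one_socle :
  (forall M : lSemiModType S, e_injective M) -> (1 : S^o) \in socle.
Proof.
move=> /subtractive_retract inj; apply: contrapT => socle1.
have socleD : {in socle, forall x, x \notin pred1 (1 : S^o)}.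
  by move=> x sx; apply/negP => /eqP x1; apply: socle1; rewrite -x1.
have [L [cL socleL LD Lmax]] := maximal_avoiding socle_closed socleD.
have L1 : (1 : S^o) \notin L by apply/negP => /LD /eqP.
have [r [rL r_id]] := inj _ _ cL (ring_subtractive ringS cL).
have rM (a x : S^o) : r (a * x) = a * r x by apply: (linearZ_LR r).
have [m mE] := ring_opp ringS.
(* [u] is [1 - r 1], the component of 1 in the kernel of [r]. *)
pose u : S^o := 1 + m *: r 1.
have r1u : r 1 + u = 1 by rewrite addrCA mE addr0.
have ru0 : r u = 0 by rewrite linearD linearZ /= (r_id (r 1)) ?mE.
(* Su is the kernel of r, a complement of L. *)
have uP (y : S^o) : r y = 0 -> y = y * u.
  by move=> ry0; rewrite -[LHS]mulr1 -r1u mulrDr -rM mulr1 ry0 add0r.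
have u0 : u != 0 by apply: contraNneq L1 => u0; rewrite -r1u u0 addr0.
have uA : atom u.
  split=> // z zu0; have [[L0 LA] LZ] := cL.
  pose P : {pred S^o} := fun x =>
    `[< exists w, exists2 l, l \in L & x = w * (z * u) + l >].
  have cP : GRing.subsemimod_closed P.
    split; [split|] => [|_ _ /asboolP[w [l Ll ->]] /asboolP[w' [l' Ll' ->]]
                        |b _ /asboolP[w [l Ll ->]]]; apply/asboolP.
    - by exists 0, 0; rewrite // mul0r addr0.
    - by exists (w + w'), (l + l'); [apply: LA|rewrite mulrDl addrACA].
    - by exists (b * w), (b * l); [apply: LZ|rewrite -mulrA -mulrDr].
  have LP : {subset L <= P}.
    by move=> l Ll; apply/asboolP; exists 0, l; rewrite // mul0r add0r.
  have /asboolP[w [l Ll e]] : (1 : S^o) \in P.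
    (* Otherwise maximality puts [P] inside [L], so that [r] fixes [z * u]; but [r] sends it to
       [z * r u = 0]. *)
    apply: contrapT => P1.
    have /(_ (z * u)) PL : {subset P <= L}.
      by apply: Lmax => // x Px; apply/negP => /eqP x1; apply: P1; rewrite -x1.
    have /r_id : (z * u : S^o) \in L.
      by apply: PL; apply/asboolP; exists 1, 0; rewrite // mul1r addr0.
    by rewrite rM ru0 mulr0 => /esym/eqP; apply/negP.
  (* Apply [r] to [u = u * 1]: the summand in [S u] vanishes and [u * l] is fixed, so
     [u * l = r u = 0]. *)
  have ul0 : u * l = 0.
    have : r (u * (w * (z * u) + l)) = 0 by rewrite -e mulr1.
    by rewrite mulrDr linearD !mulrA !rM ru0 mulr0 add0r (r_id l).
  by exists (u * w); rewrite -mulrA -[RHS]mulr1 e [RHS]mulrDr ul0 addr0.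
have /socleL/r_id : u \in socle.
  by apply/asboolP; exists [:: (1, u)];
    [move=> p /[!inE] /eqP ->|rewrite big_seq1 mul1r].
by rewrite ru0 => /esym/eqP; apply/negP.
Qed.

Definition atom_decomposition n (y c : 'I_n -> S) : Prop :=
  (forall i, atom (y i)) /\ 1 = \sum_i c i * y i.

Lemma one_socle_decomposition :
  (1 : S^o) \in socle -> exists n (y c : 'I_n -> S), atom_decomposition y c.
Proof.
move=> /asboolP[s sA e]; exists (size s).
exists (fun i => (tnth (in_tuple s) i).2), (fun i => (tnth (in_tuple s) i).1).
by split=> [i|]; [apply/sA/mem_tnth|apply: etrans e _; rewrite big_tnth].
Qed.

(* A nontrivial relation would express one of the y i through the others. *)
Lemma minimal_decomposition_free n (y c d : 'I_n -> S) :
    atom_decomposition y c ->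
    (forall k (y' c' : 'I_k -> S), atom_decomposition y' c' -> (n <= k)%N) ->
  \sum_i d i * y i = 0 -> forall i, d i * y i = 0.
Proof.
case: n => [|n] in y c d *; first by move=> _ _ _ [].
move=> [yA e] nmin d0 j; apply: contrapT => /eqP dj0.
have [w wE] := (yA j).2 _ dj0.
have [m mE] := ring_opp ringS.
have opp (x : S) : x + m * x = 0 by apply: (mE S^o).
(* Subtract [c j * w] times the relation from [1 = \sum_i c i * y i]: the [j]-th term cancels
   because [w * (d j * y j) = y j], which leaves a shorter decomposition. *)
suff /nmin : atom_decomposition (y \o lift j)
    (fun i => c (lift j i) + m * (c j * w * d (lift j i))) by rewrite ltnn.
split=> [i|]; first exact: yA.
transitivity (\sum_i (c i + m * (c j * w * d i)) * y i); last first.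
  by rewrite (bigD1_ord j) //= mulrDl -!mulrA wE opp add0r.
rewrite (eq_bigr (fun i => c i * y i + m * (c j * w) * (d i * y i))).
  by rewrite big_split /= -mulr_sumr d0 mulr0 addr0.
by move=> i _; rewrite mulrDl !mulrA.
Qed.

(** With finitely many summands, finite support is automatic and the finitely supported sum is an
    ordinary one. *)
Lemma is_direct_sum_ord (M : lSemiModType S) n (N : 'I_n -> {pred M}) :
    (forall x,
       exists2 f : 'I_n -> M, forall i, f i \in N i & x = \sum_i f i) ->
    (forall f g : 'I_n -> M, (forall i, f i \in N i) -> (forall i, g i \in N i) ->
       \sum_i f i = \sum_i g i -> f =1 g) ->
  is_direct_sum N.
Proof.
have sumE (f : 'I_n -> M) : \sum_(i \in [set: 'I_n]%classic) f i = \sum_i f i.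
  rewrite (fsbigE (index_enum 'I_n)) ?index_enum_uniq //.
    by apply: eq_bigl => i; rewrite in_setT.
  by move=> i _; rewrite mem_index_enum.
move=> span free x; have [f fN xf] := span x.
exists f; split=> [|g [gN _ xg]].
  by split=> //; [apply: finite_finset|rewrite sumE].
by apply: funext => i; apply: free => //; rewrite -xf xg sumE.
Qed.

Lemma one_socle_semisimple : (1 : S^o) \in socle -> semisimple S^o.
Proof.
move=> /one_socle_decomposition has_dec.
pose P n := `[< exists (y c : 'I_n -> S), atom_decomposition y c >].
have [|n /asboolP[y [c [yA e]]] nmin] := @ex_minnP P.
  by have [n dec] := has_dec; exists n; apply/asboolP.
exists 'I_n, (fun i => cyclic (y i)); split=> [i|]; first exact: atom_simple.
apply: is_direct_sum_ord => [x|f g fN gN fg i].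
  exists (fun i => x * c i * y i).
    by move=> i; apply/asboolP; exists (x * c i).
  transitivity ((x : S) * 1); first by rewrite mulr1.
  by rewrite e mulr_sumr; apply: eq_bigr => i _; apply: mulrA.
have /choice[a aE] i' : exists a, f i' = a * y i' by apply/asboolP/fN.
have /choice[b bE] i' : exists b, g i' = b * y i' by apply/asboolP/gN.
have [m mE] := ring_opp ringS.
have opp (x : S) : x + m * x = 0 by apply: (mE S^o).
(* Two expressions of one element are subtracted; freeness of the shortest decomposition makes each
   term of the difference vanish. *)
have /(_ i) : forall i, (a i + m * b i) * y i = 0.
  apply: (@minimal_decomposition_free _ y c); first by split.
    by move=> k y' c' dec; apply: nmin; apply/asboolP; exists y', c'.
  rewrite (eq_bigr (fun j => f j + m * g j)).
    by rewrite big_split /= -mulr_sumr fg; apply: opp.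
  by move=> j _; rewrite aE bE mulrDl mulrA.
rewrite mulrDl -mulrA -aE -bE => fg0.
apply: (ring_addrI (M := S^o) ringS (y := m * g i)).
by rewrite addrC fg0 addrC; apply/esym/opp.
Qed.

End RingToSemisimple.

(** * Splitting over a semisimple ring *)

Section ScaleBy.
Variables (S : pzSemiRingType) (A : lSemiModType S) (x : A).

Definition scale_by (s : S^o) : A := (s : S) *: x.

Lemma scale_by_semilinear : semilinear scale_by.
Proof. by split=> [a s|s t]; rewrite /scale_by ?scalerA ?scalerDl. Qed.

HB.instance Definition _ :=
  GRing.isSemilinear.Build S S^o A *:%R scale_by scale_by_semilinear.

End ScaleBy.

(** Elements [a] of [A] correspond to linear maps from [S^o] through [scale_by a]; two with the same
    image under [f] give two factorizations of one map, which uniqueness identifies. *)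
Lemma kernel_inj (S : pzSemiRingType) (A B C : lSemiModType S)
    (f : {linear A -> B}) (g : {linear B -> C}) : is_kernel f g -> injective f.
Proof.
move=> [gf0 univ] a a' faa'.
have [|k [_ k_uniq]] := univ _ (f \o scale_by a : {linear S^o -> B}).
  by move=> s; apply: gf0.
have ka : scale_by a =1 k by apply: k_uniq.
have ka' : scale_by a' =1 k.
  by apply: k_uniq => s /=; rewrite /scale_by !linearZ faa'.
by rewrite -[a]scale1r -[a']scale1r; apply: etrans (ka 1) (esym (ka' 1)).
Qed.

Section SemisimpleRing.
Variable S : pzSemiRingType.
Hypothesis ssS : semisimple_ring S.

Lemma complement (B : lSemiModType S) (F : {pred B}) :
    GRing.subsemimod_closed F ->
  exists N : {pred B}, [/\ GRing.subsemimod_closed N,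
    forall x, x \in N -> x \in F -> x = 0
    & forall b, exists n x, [/\ n \in N, x \in F & b = n + x]].
Proof.
have [ringS [I [E [simpE sumE]]]] := ssS; move=> [[F0 FD] FZ].
have c0 : GRing.subsemimod_closed (pred1 (0 : B)).
  split; [split|] => [|x y /eqP -> /eqP ->|a x /eqP ->];
    by rewrite inE ?addr0 ?scaler0.
(* Avoiding the nonzero elements of [F] means meeting [F] trivially. *)
have [|N [cN _ NF Nmax]] :=
    maximal_avoiding c0 (D := [pred x in F | x != 0]).
  by move=> x /eqP ->; rewrite inE eqxx andbF.
have [[N0 ND] NZ] := cN.
have NF0 x : x \in N -> x \in F -> x = 0.
  by move=> /NF /[swap] Fx; rewrite inE Fx => /negbNE/eqP.
exists N; split=> // b.
pose L : {pred B} := fun b =>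
  `[< exists n x, [/\ n \in N, x \in F & b = n + x] >].
have cL : GRing.subsemimod_closed L.
  split; [split|] => [|_ _ /asboolP[n [x [Nn Fx ->]]]
                          /asboolP[n' [x' [Nn' Fx' ->]]]
                      |a _ /asboolP[n [x [Nn Fx ->]]]]; apply/asboolP.
  - by exists 0, 0; rewrite addr0.
  - by exists (n + n'), (x + x'); split; [apply: ND|apply: FD|rewrite addrACA].
  - by exists (a *: n), (a *: x); split; [apply: NZ|apply: FZ|rewrite scalerDr].
have [[L0 LD] LZ] := cL.
(* Enough, because [b = 1 *: b] and 1 is a sum of elements of the [E i]. *)
suff EL i (e : S) : e \in E i -> e *: b \in L.
  have [f [[fE _ f1] _]] := sumE 1.
  apply/asboolP; rewrite -/(L b).
  have -> : b = scale_by b 1 by rewrite /scale_by scale1r.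
  rewrite f1 linear_sum.
  by elim/big_ind: _ => // j _; apply: (EL j).
move=> Ee; apply: contrapT => /negP ebL.
have [[[E0 ED] EZ] _ minE] := simpE i.
(* By simplicity of E i, the submodule (E i) b meets L trivially, so that it
   could be added to N. *)
have EbL0 (s : S) : s \in E i -> s *: b \in L -> s = 0.
  pose K : {pred S^o} := fun s => (s \in E i) && ((s : S) *: b \in L).
  have cK : GRing.subsemimod_closed K.
    split; [split|] => [|t u /andP[Et Lt] /andP[Eu Lu]|a t /andP[Et Lt]].
    - by apply/andP; rewrite E0 scale0r L0.
    - by apply/andP; rewrite ED // scalerDl LD.
    - by apply/andP; rewrite EZ // -scalerA LZ.
  have KE : {subset K <= E i} by move=> t /andP[].
  have [K0 Es Ls|KEi] := minE K cK KE.
    by apply/eqP; rewrite -[_ == _]K0; apply/andP.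
  by move: Ee; rewrite -KEi => /andP[_]; move/negP: ebL.
pose N' : {pred B} := fun x =>
  `[< exists n (s : S), [/\ n \in N, s \in E i & x = n + s *: b] >].
have : {subset N' <= N}.
  apply: Nmax => [|n Nn|_ /asboolP[n [s [Nn Es ->]]]].
  - split; [split|] => [|_ _ /asboolP[n [s [Nn Es ->]]]
                            /asboolP[n' [s' [Nn' Es' ->]]]
                        |a _ /asboolP[n [s [Nn Es ->]]]]; apply/asboolP.
    + by exists 0, 0; rewrite scale0r addr0.
    + exists (n + n'), (s + s'); split; [exact: ND|exact: ED|].
      by rewrite scalerDl addrACA.
    + exists (a *: n), (a * s); split; [exact: NZ|exact: (EZ a)|].
      by rewrite scalerDr scalerA.
  - by apply/asboolP; exists n, 0; rewrite scale0r addr0.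
  (* If [n + s *: b] is in [F], it is in [L], as is [n]; subtractivity puts [s *: b] in [L], so
     [s = 0] and the element lies in both [N] and [F]. *)
  - apply/negP => /andP[Fns /eqP[]].
    have Ln : n \in L by apply/asboolP; exists n, 0; rewrite addr0.
    have Lns : n + s *: b \in L.
      by apply/asboolP; exists 0, (n + s *: b); rewrite add0r.
    have s0 := EbL0 s Es (ring_subtractive ringS cL Ln Lns).
    by move: Fns; rewrite s0 scale0r addr0; apply: NF0.
move=> /(_ (e *: b)) Neb; move/negP: ebL; apply; apply/asboolP.
exists (e *: b), 0; rewrite addr0; split=> //; apply: Neb; apply/asboolP.
by exists 0, e; rewrite add0r.
Qed.

(** [r] takes the coordinate along the image of [f], relative to a complement; uniqueness of that
    coordinate makes [r] linear. *)
Lemma linear_retract (A B : lSemiModType S) (f : {linear A -> B}) :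
  injective f -> exists r : {linear B -> A}, forall a, r (f a) = a.
Proof.
move=> f_inj; have [ringS _] := ssS; have [m mE] := ring_opp ringS.
pose F : {pred B} := fun y => `[< exists x, f x = y >].
have [|N [[[N0 ND] NZ] NF NFB]] := @complement B F.
  split; [split|] => [|_ _ /asboolP[x <-] /asboolP[y <-]|a _ /asboolP[x <-]];
    apply/asboolP.
  - by exists 0; rewrite linear0.
  - by exists (x + y); rewrite linearD.
  - by exists (a *: x); rewrite linearZ.
have /choice[r rE] (b : B) : exists a, exists2 n, n \in N & b = n + f a.
  by have [n [_ [Nn /asboolP[a <-] ->]]] := NFB b; exists a, n.
have r_uniq b n a : n \in N -> b = n + f a -> r b = a.
  have [n' Nn' bE] := rE b; move=> Nn bE'.
  (* Two decompositions of [b] differ by an element common to [N] and the image of [f], which is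
     0. *)
  have e : n' + m *: n = f a + m *: f (r b).
    apply: (ring_addrI ringS (y := n + f (r b))).
    rewrite [n' + _]addrC addrACA mE add0r [RHS]addrACA mE addr0 -bE' {2}bE.
    exact: addrC.
  have fa0 : f a + m *: f (r b) = 0.
    apply: NF; first by rewrite -e; apply: ND => //; apply: NZ.
    by apply/asboolP; exists (a + m *: r b); rewrite linearD linearZ.
  apply: f_inj; apply: (ring_addrI ringS (y := m *: f (r b))).
  by rewrite [LHS]addrC mE addrC.
have r_lin : semilinear r.
  split=> [a x|x y].
    have [n Nn xE] := rE x.
    by apply: (r_uniq _ (a *: n)); rewrite ?NZ // {1}xE scalerDr linearZ.
  have [[n Nn xE] [n' Nn' yE]] := (rE x, rE y).
  by apply: (r_uniq _ (n + n')); rewrite ?ND // {1}xE {1}yE linearD addrACA.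
exists (linear_of r_lin) => a; apply: (r_uniq _ 0) => //.
by rewrite add0r.
Qed.

(** The map [b - f (r b)] kills the image of [f], so it factors through the cokernel [g], and [s] is
    the factor. *)
Lemma short_exact_split (A B C : lSemiModType S)
    (f : {linear A -> B}) (g : {linear B -> C}) :
    short_exact f g ->
  exists (r : {linear B -> A}) (s : {linear C -> B}),
    (forall a, r (f a) = a) /\ forall b, f (r b) + s (g b) = b.
Proof.
have [ringS _] := ssS; have [m mE] := ring_opp ringS.
move=> [/kernel_inj/linear_retract[r rf] [_ univ]].
(* Centrality of -1 makes [b - f (r b)] linear in [b]. *)
have mC a : m * a = a * m.
  have opp (x : S) : x + m * x = 0 by apply: (mE S^o).
  apply: (ring_addrI (M := S^o) ringS (y := a)); rewrite [LHS]opp.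
  transitivity (a * (1 + m * 1)); first by rewrite opp mulr0.
  by rewrite mulrDr !mulr1.
have h_lin : semilinear (fun b => b + m *: f (r b)).
  split=> [a x|x y]; first by rewrite !linearZ scalerDr !scalerA mC.
  by rewrite !linearD scalerDr addrACA.
have [|s [sE _]] := univ _ (linear_of h_lin).
  by move=> a /=; rewrite rf mE.
exists r, s; split=> // b; rewrite [s _]sE /=.
by rewrite addrCA mE addr0.
Qed.

(** Precomposition with [r] and [s] splits the Hom sequence: a map [b] on [B] equals
    [(b \o f) \o r + (b \o s) \o g]. *)
Lemma semisimple_ring_e_injective (M : lSemiModType S) : e_injective M.
Proof.
move=> A B C f g fg; have [r [s [rf fr_sg]]] := short_exact_split fg.
have [[gf0 _] [_ univ]] := fg.
have comp0 h : hom_precomp M f (hom_precomp M g h) = 0.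
  by apply: linear_eqP => a /=; rewrite gf0 linear0.
split; split=> // X h h0.
  have h0E x a : h x (f a) = 0.
    exact: (congr1 (fun k : {linear A -> M} => k a) (h0 x)).
  exists (hom_precomp M s \o h); split=> [x|k' k'E x]; apply: linear_eqP.
    by move=> b /=; rewrite -[in RHS](fr_sg b) linearD h0E add0r.
  (* [k' x] and [h x \o s] both factor [h x] through the cokernel [g], so they agree. *)
  have [k [_ k_uniq]] := univ _ (h x) (h0E x).
  move=> c; rewrite (k_uniq (k' x)) => [|b]; last by rewrite -k'E.
  apply/esym/k_uniq => b /=.
  by rewrite -[in RHS](fr_sg b) linearD h0E add0r.
exists (h \o hom_precomp M r); split=> [b|k' k'E a] /=.
  have {2}-> : b = hom_precomp M r (hom_precomp M f b) +
                   hom_precomp M g (hom_precomp M s b).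
    by apply: linear_eqP => x /=; rewrite -linearD fr_sg.
  by rewrite raddfD /= [X in _ + X]h0 addr0.
rewrite -k'E /=; congr (k' _).
by apply: linear_eqP => x /=; rewrite rf.
Qed.

End SemisimpleRing.

Theorem theorem5p3 (S : pzSemiRingType) :
  (forall M : lSemiModType S, e_injective M) <-> semisimple_ring S.
Proof.
split=> [inj|ssS M]; last exact: semisimple_ring_e_injective.
have ringS := e_injective_is_ring inj.
by split=> //; apply/one_socle_semisimple/e_injective_one_socle.
Qed.
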